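(* Let $G=(V,E,\{c_e\}_{e\in E})$ be a finite undirected graph with positive edge conductances $c_e>0$, $n\ge2$ vertices and $m$ edges, each edge oriented arbitrarily. Let $\Pi:=C^{1/2}BL^+B^\top C^{1/2}$ and let $\overline{\Pi}$ denote its entrywise absolute value. Then $$\|\overline{\Pi}\|_{2\to2}\le 2\log n,$$ where $\|\cdot\|_{2\to2}$ is the spectral norm and $\log$ is the natural logarithm.
   Context: For a vertex $v$, $\mathbbm{1}_v\in\mathbb{R}^V$ is the standard basis vector. For an edge $e$ oriented from $e^-$ to $e^+$, $b_e:=\mathbbm{1}_{e^+}-\mathbbm{1}_{e^-}$; $B\in\mathbb{R}^{E\times V}$ is the matrix with row $b_e^\top$ for each $e$. $C=\operatorname{diag}(c_e)_{e\in E}$, $L:=B^\top CB$ is the weighted Laplacian, and $L^+$ is its Moore–Penrose pseudoinverse. Graphs have no self-loops; parallel edges are allowed. *)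

(* Defs.v *)
From HB Require Import structures.
From mathcomp Require Import all_boot all_order all_algebra.
From mathcomp Require Import all_classical all_reals.
From mathcomp Require Import exp.
Set Implicit Arguments. Unset Strict Implicit. Unset Printing Implicit Defensive.
Import Order.TTheory GRing.Theory Num.Theory.
Local Open Scope ring_scope.
Local Open Scope classical_set_scope.

Definition incidence (R : pzRingType) (n m : nat) (tl hd : 'I_m -> 'I_n)
  : 'M[R]_(m, n) :=
  \matrix_(e, v) ((v == hd e)%:R - (v == tl e)%:R).

Definition diagm (R : pzRingType) (m : nat) (d : 'I_m -> R) : 'M[R]_m :=
  diag_mx (\row_e d e).

Definition laplacian (R : pzRingType) (n m : nat) (tl hd : 'I_m -> 'I_n)
  (c : 'I_m -> R) : 'M[R]_n :=
  (@incidence R _ _ tl hd)^T *m diagm c *m @incidence R _ _ tl hd.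

(* X is the Moore-Penrose pseudoinverse of the real matrix A
   (the four Penrose conditions, which determine X uniquely). *)
Definition is_MP_pinv (R : pzRingType) (n : nat) (A X : 'M[R]_n) : Prop :=
  [/\ A *m X *m A = A, X *m A *m X = X,
      (A *m X)^T = A *m X & (X *m A)^T = X *m A].

Definition norm2 (R : realType) (m : nat) (x : 'cV[R]_m) : R :=
  Num.sqrt (\sum_i x i 0 ^+ 2).

Definition spec_norm (R : realType) (m : nat) (A : 'M[R]_m) : R :=
  sup [set norm2 (A *m x) | x in [set x : 'cV[R]_m | norm2 x <= 1]].

Definition projPi (R : realType) (n m : nat) (tl hd : 'I_m -> 'I_n)
  (c : 'I_m -> R) (Lp : 'M[R]_n) : 'M[R]_m :=
  let Ch := diagm (fun e => Num.sqrt (c e)) in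
  let B := @incidence R _ _ tl hd in
  Ch *m B *m Lp *m B^T *m Ch.

(* Main.v *)
Require Import Defs.
From HB Require Import structures.
From mathcomp Require Import all_boot all_order all_algebra.
From mathcomp Require Import ring lra.
From mathcomp Require Import all_classical all_reals.
From mathcomp Require Import topology normedtype derive realfun.
From mathcomp Require Import exp.
Set Implicit Arguments. Unset Strict Implicit. Unset Printing Implicit Defensive.
Import Order.TTheory GRing.Theory Num.Theory.
Import numFieldNormedType.Exports.
Local Open Scope ring_scope.

(**
  For nonnegative unit edge vectors x and y, let m be the probability measure
  on vertices which splits the mass (x_e^2 + y_e^2) / 2 of each edge e evenly
  between its two ends. With M = diag m, the heat semigroup of M^-1 L has
  kernels k_s = exp (- s M^-1 L) M^-1, and on differences of vertices L^+ is
  the integral of k_s over s >= 0. Writing k_s = k_(s/2) M k_(s/2), one gets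
  |b_e L^+ b_f| <= \int \sum_v m_v |b_e k_(s/2)^v| |b_f k_(s/2)^v| ds. Since the
  logarithmic mean is at most the arithmetic one, Cauchy-Schwarz bounds the
  resulting bilinear form in x and y by the Fisher information of the density
  k_(s/2)^v times \sum_u m_u k_(s/2)^v(u) = 1: this is what m was chosen for.
  The Fisher information is the rate of decay of the entropy of k^v, which
  starts at - ln m_v and stays nonnegative, so the total is at most
  2 \sum_v m_v (- ln m_v) <= 2 ln n.

  The semigroup is replaced by the implicit Euler scheme
  (M + tau L) k_(j+1) = M k_j, along which convexity of t ln t still gives the
  entropy decay with the sharp constant, and then tau -> 0. The measure m
  receives a small uniform part, so as to be positive.
*)

(** * Scalar inequalities for the logarithm *)

Lemma ln_ge_sub1V (R : realType) (t : R) : 0 < t -> 1 - t^-1 <= ln t.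
Proof.
move=> t0.
have h : -1 < t^-1 - 1 by rewrite ltrBrDr addNr invr_gt0.
have := le_ln1Dx h; rewrite addrC subrK lnV ?posrE // => h1.
by rewrite lerNl opprB in h1.
Qed.

Lemma ln_ge_logmean (R : realType) (t : R) :
  1 <= t -> 2 * (t - 1) / (t + 1) <= ln t.
Proof.
move=> t1.
(* [f] is the difference of the two sides; it vanishes at 1 and has derivative
   [(x - 1)^2 / (x (x + 1)^2)]. *)
pose f (x : R) := ln x - 2 + 4 * (x + 1)^-1.
have df (x : R) : 1 <= x -> is_derive x 1 f (x^-1 - 4 / (x + 1) ^+ 2).
  move=> x1.
  have x0 : 0 < x by lra.
  have x10 : x + 1 != 0 by apply: lt0r_neq0; lra.
  have h1 := is_derive1_ln x0.
  have h2 : is_derive x 1 (fun y : R => y + 1) (1 : R).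
    apply: is_derive_eq; by rewrite addr0.
  have h3 := is_deriveV (f := fun y : R => y + 1) x10 h2.
  rewrite /f; apply: is_derive_eq.
  rewrite /GRing.scale /= ; field.
  by rewrite x10 lt0r_neq0.
have h : f 1 <= f t.
  apply: (ger0_derive1_ndecry (a := 1)) => // [x|x|].
  - by rewrite in_itv /= andbT => /ltW /df [].
  - rewrite in_itv /= andbT => x1.
    rewrite derive1E (@derive_val _ _ _ _ _ _ _ (df x (ltW x1))).
    rewrite subr_ge0 ler_pdivrMr; last by apply: exprn_gt0; lra.
    rewrite mulrC ler_pdivlMr; last lra.
    have := sqr_ge0 (x - 1); rewrite !expr2; lra.
  - apply: derivable_within_continuous => x.
    by rewrite in_itv /= andbT => /df [].
move: h; rewrite /f ln1.
have -> : 2 * (t - 1) / (t + 1) = 2 - 4 * (t + 1)^-1.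
  by field; apply: lt0r_neq0; lra.
have -> : (4 * (1 + 1)^-1 : R) = 2 by field.
lra.
Qed.

(** The logarithmic mean [(a - b) / (ln a - ln b)] is at most the arithmetic mean, multiplied out so
    that [a = b] needs no exception; [ln_ge_logmean] is applied at [a / b]. *)
Lemma sqr_sub_le_logmean (R : realType) (a b : R) : 0 < a -> 0 < b ->
  (a - b) ^+ 2 <= (a + b) / 2 * ((a - b) * (ln a - ln b)).
Proof.
wlog ab : a b / b <= a.
  move=> H a0 b0; have [ba|/ltW ab] := leP b a; first exact: H.
  have := H b a ab b0 a0; rewrite !expr2; lra.
move=> a0 b0; rewrite -ln_div ?posrE //.
have h1 : 1 <= a / b by rewrite ler_pdivlMr ?mul1r.
have := ln_ge_logmean h1.
have -> : 2 * (a / b - 1) / (a / b + 1) = 2 * (a - b) / (a + b).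
  by field; rewrite !lt0r_neq0 // addr_gt0.
rewrite ler_pdivrMr ?addr_gt0 // => h.
have : (a - b) * (2 * (a - b)) <= (a - b) * (ln (a / b) * (a + b)).
  by rewrite ler_wpM2l // subr_ge0.
rewrite expr2; lra.
Qed.

(** The graph of [t ln t] lies above its tangent at [x]. At [x = 0] the true slope is minus infinity
    while [ln 0 = 0], so there [y] must vanish too. *)
Lemma xlnx_convex (R : realType) (x y : R) : 0 <= x -> 0 <= y ->
  (x = 0 -> y = 0) -> (y - x) * (ln x + 1) <= y * ln y - x * ln x.
Proof.
rewrite le_eqVlt => /orP[/eqP <- _ /(_ erefl) ->|x0]; first by rewrite !mul0r subrr mul0r.
rewrite le_eqVlt => /orP[/eqP <- _|y0 _]; first by rewrite !mul0r; lra.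
have h1 : 0 < x / y by rewrite divr_gt0.
have h2 : 0 < y / x by rewrite divr_gt0.
have := ln_ge_sub1V h2; rewrite invf_div ln_div ?posrE // => h.
have : y * (1 - x / y) <= y * (ln y - ln x) by rewrite ler_wpM2l // ltW.
have -> : y * (1 - x / y) = y - x by field; rewrite lt0r_neq0.
lra.
Qed.

(** * Quadratic forms and positive semidefinite matrices *)

Section QuadraticForms.
Variables (R : realFieldType) (n : nat).
Implicit Types (P Q : 'M[R]_n) (z : 'cV[R]_n).

Definition qform P z : R := (z^T *m P *m z) 0 0.
Definition psdmx P := forall z, 0 <= qform P z.

Lemma qformD P Q z : qform (P + Q) z = qform P z + qform Q z.
Proof. by rewrite /qform mulmxDr mulmxDl mxE. Qed.

Lemma qformN P z : qform (- P) z = - qform P z.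
Proof. by rewrite /qform mulmxN mulNmx mxE. Qed.

Lemma qformB P Q z : qform (P - Q) z = qform P z - qform Q z.
Proof. by rewrite qformD qformN. Qed.

Lemma qformZ a P z : qform (a *: P) z = a * qform P z.
Proof. by rewrite /qform -scalemxAr -scalemxAl mxE. Qed.

Lemma psdmxD P Q : psdmx P -> psdmx Q -> psdmx (P + Q).
Proof. by move=> hP hQ z; rewrite qformD addr_ge0. Qed.

Lemma psdmxZ a P : 0 <= a -> psdmx P -> psdmx (a *: P).
Proof. by move=> ha hP z; rewrite qformZ mulr_ge0. Qed.

(** Additive Cauchy-Schwarz, read off from the nonnegativity of the form at [z + w] and [z - w]. *)
Lemma psdmx_bilinear_le P z w : P^T = P -> psdmx P ->
  `|(z^T *m P *m w) 0 0| <= (qform P z + qform P w) / 2.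
Proof.
move=> sP hP.
have sym : (w^T *m P *m z) 0 0 = (z^T *m P *m w) 0 0.
  have -> : w^T *m P *m z = (z^T *m P *m w)^T.
    by rewrite !trmx_mul sP trmxK mulmxA.
  by rewrite mxE.
have addE (X Y : 'M[R]_1) : (X + Y) 0 0 = X 0 0 + Y 0 0 by rewrite mxE.
have oppE (X : 'M[R]_1) : (- X) 0 0 = - X 0 0 by rewrite mxE.
have h1 := hP (z + w); have h2 := hP (z - w).
have e1 : qform P (z + w) = qform P z + qform P w + 2 * (z^T *m P *m w) 0 0.
  rewrite /qform (raddfD (@trmx R n 1)) /= !mulmxDl !mulmxDr !addE sym; ring.
have e2 : qform P (z - w) = qform P z + qform P w - 2 * (z^T *m P *m w) 0 0.
  rewrite /qform (raddfB (@trmx R n 1)) /= !mulmxBl !mulmxBr !(addE, oppE) sym; ring.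
rewrite ler_norml; apply/andP; split; lra.
Qed.

End QuadraticForms.

Lemma psdmx_congr (R : realFieldType) (n p : nat) (S : 'M[R]_(n, p)) (P : 'M[R]_n) :
  psdmx P -> psdmx (S^T *m P *m S).
Proof. by move=> hP z; rewrite /qform !mulmxA -trmx_mul -mulmxA; exact: hP. Qed.

(** * The implicit Euler scheme and its discretization error *)

Section ImplicitEuler.
Variables (R : realFieldType) (n : nat) (M D G L : 'M[R]_n) (tau : R).
Hypotheses (symM : M^T = M) (symL : L^T = L).
Hypotheses (psdM : psdmx M) (psdD : psdmx D) (psdL : psdmx L).
Hypotheses (tau_gt0 : 0 < tau).
Hypotheses (DM : D *m M = 1%:M) (GA : G *m (M + tau *: L) = 1%:M).

(** Discrete counterpart of [exp (- j tau M^-1 L) M^-1]. The final factor [M^-1 = D] makes these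
    kernels symmetric. *)
Fixpoint heat (j : nat) : 'M[R]_n :=
  if j is i.+1 then G *m M *m heat i else D.


#[local] Arguments heat : simpl never.
Let A := M + tau *: L.
Let MD : M *m D = 1%:M. Proof. exact: mulmx1C. Qed.
Let AG : A *m G = 1%:M. Proof. exact: mulmx1C. Qed.
Let symA : A^T = A. Proof. by rewrite /A linearD linearZ /= symM symL. Qed.
Let symD : D^T = D.
Proof.
by rewrite -[LHS]mulmx1 -MD mulmxA -{1}symM -trmx_mul MD trmx1 mul1mx.
Qed.
Let symG : G^T = G.
Proof.
by rewrite -[LHS]mulmx1 -AG mulmxA -{1}symA -trmx_mul AG trmx1 mul1mx.
Qed.
Let AM : A - M = tau *: L. Proof. by rewrite /A addrC addKr. Qed.

Let heat0 : heat 0 = D. Proof. by []. Qed.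
Let heatS j : heat j.+1 = G *m M *m heat j. Proof. by []. Qed.

Lemma heat1 : heat 1 = G.
Proof. by rewrite heatS heat0 -mulmxA MD mulmx1. Qed.

Lemma heatSr j : heat j.+1 = heat j *m M *m G.
Proof.
elim: j => [|j IH]; first by rewrite heat1 heat0 DM mul1mx.
by rewrite [LHS]heatS {1}IH heatS !mulmxA.
Qed.

Lemma heat_sym j : (heat j)^T = heat j.
Proof.
elim: j => [|j IH]; first exact: symD.
by rewrite {1}heatSr !trmx_mul IH symG symM mulmxA.
Qed.

Lemma heat_add i j : heat (i + j) = heat i *m M *m heat j.
Proof.
elim: i => [|i IH]; first by rewrite heat0 DM mul1mx.
by rewrite addSn !heatS IH !mulmxA.
Qed.

Lemma heat_step j : M *m heat j - M *m heat j.+1 = tau *: (L *m heat j.+1).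
Proof.
apply/eqP; rewrite subr_eq addrC scalemxAl -mulmxDl -/A heatS !mulmxA AG.
by rewrite mul1mx.
Qed.

Lemma heat_stepr j : heat j *m M - heat j.+1 *m M = tau *: (heat j.+1 *m L).
Proof.
have := congr1 trmx (heat_step j).
by rewrite linearB linearZ /= !(trmx_mul M) (trmx_mul L) !heat_sym symM symL.
Qed.

Let heatSS j : heat j.+2 = (M *m G)^T *m heat j *m (M *m G).
Proof. by rewrite heatSr heatS trmx_mul symG symM !mulmxA. Qed.

Let psdG : psdmx G.
Proof.
have -> : G = G^T *m A *m G by rewrite -mulmxA AG mulmx1.
by apply: psdmx_congr; apply: psdmxD => //; apply: psdmxZ => //; exact: ltW.
Qed.

Lemma heat_psd j : psdmx (heat j).
Proof.
(* Two steps act by a congruence ([heatSS]), so the induction advances by two and needs two base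
   cases. *)
suff : psdmx (heat j) /\ psdmx (heat j.+1) by case.
elim: j => [|j [IH1 IH2]]; first by split; [|rewrite heat1].
by split => //; rewrite heatSS; apply: psdmx_congr.
Qed.

Lemma heat_decr j : psdmx (heat j - heat j.+1).
Proof.
suff : psdmx (heat j - heat j.+1) /\ psdmx (heat j.+1 - heat j.+2) by case.
elim: j => [|j [IH1 IH2]]; last first.
  split => //; rewrite !heatSS -mulmxBl -mulmxBr; exact: psdmx_congr.
rewrite heat0 heat1; split.
  (* With [A - M = tau L], the middle factor is [A D A - A]; multiplying by [G = A^-1] on both sides
     gives [D - G]. *)
  have -> : D - G = G^T *m (tau *: L + (tau *: L)^T *m D *m (tau *: L)) *m G.
    have symAM : (A - M)^T = A - M by rewrite linearB /= symA symM.
    rewrite -AM symAM symG.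
    have -> : A - M + (A - M) *m D *m (A - M) = A *m D *m A - A.
      rewrite !(mulmxBr, mulmxBl) MD mul1mx mul1mx.
      rewrite -[A *m D *m M]mulmxA DM mulmx1; apply/matrixP => i j; rewrite !mxE; ring.
    by rewrite mulmxBr mulmxBl !mulmxA GA !mul1mx -mulmxA AG mulmx1.
  apply: psdmx_congr; apply: psdmxD; first by apply: psdmxZ => //; exact: ltW.
  exact: psdmx_congr.
have -> : G - heat 2 = G^T *m (tau *: L) *m G.
  by rewrite heatSr heat1 symG -AM mulmxBr mulmxBl GA mul1mx.
by apply: psdmx_congr; apply: psdmxZ => //; exact: ltW.
Qed.

(** Up to sign, [r] and [q] are the first and second discrete time derivatives of [t], see [tS] and
    [rS]. *)
Let q j z := qform (L *m heat j *m L) z.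
Let r j z := qform (L *m heat j *m M) z.
Let t j z := qform (M *m heat j *m M) z.

Let q_decr j z : q j.+1 z <= q j z.
Proof.
rewrite -subr_ge0 -qformB -mulmxBl -mulmxBr -{1}symL.
exact: psdmx_congr (heat_decr j) z.
Qed.

Let q_ge0 j z : 0 <= q j z.
Proof. rewrite /q -{1}symL; exact: psdmx_congr (heat_psd j) z. Qed.

Let t_ge0 j z : 0 <= t j z.
Proof. rewrite /t -{1}symM; exact: psdmx_congr (heat_psd j) z. Qed.

Let rS j z : r j z - r j.+1 z = tau * q j.+1 z.
Proof.
rewrite -qformB -!(mulmxA L) -mulmxBr heat_stepr -scalemxAr qformZ.
by rewrite (mulmxA L).
Qed.

Let tS j z : t j z - t j.+1 z = tau * r j.+1 z.
Proof. by rewrite -qformB -mulmxBl heat_step -scalemxAl qformZ. Qed.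

Let r_ge0 j z : 0 <= r j.+1 z.
Proof.
rewrite -(pmulr_rge0 _ tau_gt0) -tS -qformB -mulmxBl -mulmxBr -{1}symM.
exact: psdmx_congr (heat_decr j) z.
Qed.

Let r_decr i j z : (i <= j)%N -> r j z <= r i z.
Proof.
move=> /subnK <-; elim: (j - i)%N => [|k IH]; first by rewrite add0n.
by apply: le_trans IH; rewrite -subr_ge0 rS mulr_ge0 // ltW.
Qed.

(** As [r] decreases and [tau * r] telescopes to a drop of [t], which starts at [qform M z], [r j]
    decays like [1 / (j tau)] without any spectral gap. *)
Let r_le j z : j%:R * (tau * r j z) <= qform M z.
Proof.
suff : j%:R * (tau * r j z) <= t 0 z - t j z.
  move=> /le_trans; apply; rewrite {1}/t heat0 MD mul1mx gerBl; exact: t_ge0.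
elim: j => [|j IH]; first by rewrite mul0r subrr.
have e := tS j z; have := r_decr z (leqnSn j).
have : 0 <= (j%:R * tau : R) by rewrite mulr_ge0 // ltW.
move=> h1 h2; have := ler_wpM2l h1 h2; rewrite -natr1; nra.
Qed.

(* The weights are those of the even kernels only, so the Riemann sum of step
   [2 tau] differs from the exact telescoping sum over all kernels. *)
Definition heat_defect N : 'M[R]_n :=
  L - (2 * tau) *: \sum_(j < N) L *m heat (j.+1 + j.+1) *m L.

Lemma heat_defect_sym N : (heat_defect N)^T = heat_defect N.
Proof.
rewrite /heat_defect linearB linearZ /= symL raddf_sum; congr (_ - _ *: _).
apply: eq_bigr => j _.
rewrite -[LHS]/((L *m heat (j.+1 + j.+1) *m L)^T).
by rewrite trmx_mul (trmx_mul L) heat_sym symL mulmxA.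
Qed.

Let defectS N z : qform (heat_defect N.+1) z =
  qform (heat_defect N) z - 2 * tau * q (N + N).+2 z.
Proof.
rewrite /heat_defect big_ord_recr /= scalerDr opprD addrA qformB qformZ.
by rewrite addnS.
Qed.

(** From [N] to [N + 1] the defect loses [2 tau q_(2N+2)] and [r] loses [tau (q_(2N+1) + q_(2N+2))].
    Since [q] decreases, the gap grows by an amount between 0 and [tau (q_(2N) - q_(2N+2))], which
    telescopes. *)
Let defect_bounds N z :
  r (N + N) z <= qform (heat_defect N) z <=
    r (N + N) z + tau * (q 0 z - q (N + N) z).
Proof.
elim: N => [|N /andP[IH1 IH2]].
  rewrite /heat_defect big_ord0 scaler0 subr0 /r heat0 -mulmxA DM mulmx1.
  by rewrite subrr mulr0 addr0 lexx.
rewrite defectS addnS addSn.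
have e1 := rS (N + N)%N z; have e2 := rS (N + N).+1 z.
have h1 := q_decr (N + N)%N z; have h2 := q_decr (N + N).+1 z.
have g1 := ler_wpM2l (ltW tau_gt0) h1; have g2 := ler_wpM2l (ltW tau_gt0) h2.
apply/andP; split; lra.
Qed.

Lemma heat_defect_psd N : psdmx (heat_defect N.+1).
Proof.
by move=> z; have /andP[/(le_trans _)-> //] := defect_bounds N.+1 z; apply: r_ge0.
Qed.

(** The first error comes from truncating at time [2 (N + 1) tau], the second from discretizing
    time. *)
Lemma heat_defect_le N z : qform (heat_defect N.+1) z <=
  qform M z / ((N.+1 + N.+1)%:R * tau) + tau * qform (L *m D *m L) z.
Proof.
have /andP[_ /le_trans] := defect_bounds N.+1 z; apply; apply: lerD.
  by rewrite ler_pdivlMr ?mulr_gt0 // mulrC -mulrA r_le.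
by apply: ler_wpM2l; [exact: ltW | rewrite gerBl; exact: q_ge0].
Qed.

End ImplicitEuler.

Arguments heat : simpl never.

(** * Heat flow on the graph: minimum principle, Fisher information, entropy *)

Lemma prod_le_of_sqr_le (R : realDomainType) (p q a b a' b' : R) :
  0 <= p -> 0 <= q -> 0 <= a -> 0 <= b -> 0 <= a' -> 0 <= b' ->
  p ^+ 2 <= a * b -> q ^+ 2 <= a' * b' -> 2 * (p * q) <= a * b' + a' * b.
Proof.
move=> p0 q0 a0 b0 a'0 b'0 hp hq.
rewrite -ler_sqr ?nnegrE ?mulr_ge0 ?addr_ge0 ?mulr_ge0 //.
have h : p ^+ 2 * q ^+ 2 <= (a * b) * (a' * b').
  by apply: ler_pM => //; exact: sqr_ge0.
have := sqr_ge0 (a * b' - a' * b); rewrite !expr2 in h *; nra.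
Qed.

Section GraphHeat.
Variables (R : realType) (n m : nat) (tl hd : 'I_m -> 'I_n) (c : 'I_m -> R).
Hypothesis c_gt0 : forall e, 0 < c e.
Variables (mu : 'I_n -> R) (tau : R).
Hypotheses (mu_gt0 : forall u, 0 < mu u) (tau_gt0 : 0 < tau).
Implicit Types (k g : 'I_n -> R).

Definition edge_diff k e := k (hd e) - k (tl e).
Definition lap k u :=
  \sum_e c e * edge_diff k e * ((u == hd e)%:R - (u == tl e)%:R).
(** The Dirichlet form of [k] against [ln k], which is the entropy dissipation rate of the
    continuous flow. *)
Definition fisher k :=
  \sum_e c e * (edge_diff k e * edge_diff (fun u => ln (k u)) e).
Definition entropy k := \sum_u mu u * (k u * ln (k u)).
Definition euler_step k k' := forall u, mu u * k u = mu u * k' u + tau * lap k' u.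

Lemma sum_delta (i : 'I_n) (F : 'I_n -> R) : \sum_u (u == i)%:R * F u = F i.
Proof.
rewrite (bigD1 i) //= eqxx mul1r big1 ?addr0 // => u /negbTE ->.
by rewrite mul0r.
Qed.

Lemma lap_ibp k g : \sum_u lap k u * g u =
  \sum_e c e * (edge_diff k e * edge_diff g e).
Proof.
under eq_bigr => u _ do rewrite mulr_suml.
rewrite exchange_big; apply: eq_bigr => e _.
under eq_bigr => u _ do rewrite -mulrA.
rewrite -mulr_sumr -mulrA; congr (_ * (_ * _)).
under eq_bigr => u _ do rewrite mulrBl.
by rewrite sumrB !sum_delta.
Qed.

(** Stated per edge rather than for the sum, so that a zero Laplacian at a minimum makes every term
    vanish. *)
Lemma lap_min_term k u : (forall w, k u <= k w) ->
  forall e, c e * edge_diff k e * ((u == hd e)%:R - (u == tl e)%:R) <= 0.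
Proof.
move=> umin e; rewrite /edge_diff -mulrA pmulr_rle0 //.
have h1 := umin (hd e); have h2 := umin (tl e).
case: eqVneq => [eh|_]; case: eqVneq => [et|_];
  rewrite ?eh ?et /= ?subrr ?mulr0 // -?eh -?et; lra.
Qed.

Lemma euler_step_ge0 k k' : euler_step k k' -> (forall u, 0 <= k u) ->
  forall u, 0 <= k' u.
Proof.
move=> st k0 u0.
(* Minimum principle: where [k'] is smallest its Laplacian is nonpositive, so [mu u * k' u] is at
   least [mu u * k u]. *)
have [u _ umin] := @Order.TotalTheory.arg_minP _ _ _ u0 xpredT k' isT.
apply: le_trans (umin u0 isT).
have : 0 <= mu u * k' u + tau * lap k' u by rewrite -st mulr_ge0 // ltW.
have : lap k' u <= 0.
  by apply: sumr_le0 => e _; apply: lap_min_term => w; exact: umin.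
move=> h1 h2.
have h3 : 0 <= mu u * k' u by have := mulr_ge0_le0 (ltW tau_gt0) h1; lra.
by rewrite pmulr_rge0 in h3.
Qed.

Section OneStep.
Variables (k k' : 'I_n -> R).
Hypotheses (step : euler_step k k') (k_ge0 : forall u, 0 <= k u).
Let k'_ge0 := euler_step_ge0 step k_ge0.

(** A zero of [k'] is a global minimum, so the step equates a nonnegative quantity with a
    nonpositive one. *)
Lemma euler_step_eq0 u : k' u = 0 -> k u = 0 /\ lap k' u = 0.
Proof.
move=> ku; have := step u; rewrite ku mulr0 add0r => e.
have h1 : lap k' u <= 0.
  by apply: sumr_le0 => f _; apply: lap_min_term => w; rewrite ku.
have h2 := mulr_ge0_le0 (ltW tau_gt0) h1.
have h3 : 0 <= mu u * k u by rewrite mulr_ge0 // ltW.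
have k0 : mu u * k u = 0 by lra.
split; first by move/eqP: k0; rewrite mulf_eq0 gt_eqF //= => /eqP.
by move/eqP: e; rewrite k0 eq_sym mulf_eq0 gt_eqF //= => /eqP.
Qed.

(* Strong minimum principle: the zero set of [k'] is a union of components. *)
Lemma euler_step_edge0 e : (k' (hd e) == 0) = (k' (tl e) == 0).
Proof.
have main u : k' u = 0 -> edge_diff k' e * ((u == hd e)%:R - (u == tl e)%:R) = 0.
  move=> ku; have [_ /eqP] := euler_step_eq0 ku.
  rewrite /lap -oppr_eq0 -sumrN psumr_eq0; last first.
    by move=> f _; rewrite oppr_ge0; apply: lap_min_term => w; rewrite ku.
  move/allP => /(_ e (mem_index_enum _)) /=; rewrite oppr_eq0 -mulrA mulf_eq0.
  by rewrite gt_eqF //= => /eqP.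
have [<-//|ne] := eqVneq (hd e) (tl e).
apply/eqP/eqP => h0; have := main _ h0; rewrite eqxx.
  rewrite (negbTE ne) subr0 mulr1 /edge_diff h0 sub0r => /eqP.
  by rewrite oppr_eq0 => /eqP.
by rewrite eq_sym (negbTE ne) sub0r mulrN1 /edge_diff h0 subr0 => /eqP;
  rewrite oppr_eq0 => /eqP.
Qed.

(** By [euler_step_edge0] the ends of an edge are both positive or both zero; a mixed edge could
    break the bound because [ln 0 = 0]. *)
Lemma euler_step_logmean e : edge_diff k' e ^+ 2 <=
  (k' (hd e) + k' (tl e)) / 2 *
    (edge_diff k' e * edge_diff (fun u => ln (k' u)) e).
Proof.
have := euler_step_edge0 e; have := k'_ge0 (hd e); have := k'_ge0 (tl e).
rewrite !(le_eqVlt 0 (k' _)) ![0 == _]eq_sym /edge_diff.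
case: eqVneq => [->|_ /= ht].
  by move=> _ _ /eqP ->; rewrite subrr expr0n /= !(mul0r, mulr0).
case: eqVneq => // _ /= hh _; exact: sqr_sub_le_logmean.
Qed.

Lemma fisher_term_ge0 e : 0 <= edge_diff k' e * edge_diff (fun u => ln (k' u)) e.
Proof.
have := euler_step_edge0 e; have := k'_ge0 (hd e); have := k'_ge0 (tl e).
rewrite !(le_eqVlt 0 (k' _)) ![0 == _]eq_sym /edge_diff.
case: eqVneq => [->|_ /= ht].
  by move=> _ _ /eqP ->; rewrite subrr mul0r.
case: eqVneq => // _ /= hh _.
have [hle|/ltW hle] := leP (k' (tl e)) (k' (hd e)).
  by rewrite mulr_ge0 // subr_ge0 // ler_ln ?posrE.
by rewrite mulr_le0 // subr_le0 // ler_ln ?posrE.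
Qed.

Lemma euler_step_mass : \sum_u mu u * k' u = \sum_u mu u * k u.
Proof.
under [RHS]eq_bigr => u _ do rewrite step.
have l0 : \sum_u lap k' u = 0.
  rewrite -[LHS]mulr1 mulr_suml lap_ibp big1 // => e _.
  by rewrite /edge_diff subrr !mulr0.
by rewrite big_split /= -mulr_sumr l0 mulr0 addr0.
Qed.

(* Convexity of [t ln t] makes the implicit scheme dissipate at least the
   Fisher information of the new density. *)
Lemma euler_step_entropy : tau * fisher k' <= entropy k - entropy k'.
Proof.
(* Summation by parts; the added 1 is constant, hence harmless, and completes the derivative of
   [t ln t]. *)
have -> : fisher k' = \sum_u lap k' u * (ln (k' u) + 1).
  rewrite lap_ibp; apply: eq_bigr => e _; rewrite /edge_diff; congr (_ * (_ * _)).
  ring.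
rewrite mulr_sumr /entropy -sumrB; apply: ler_sum => u _.
rewrite mulrA -mulrBr.
have -> : tau * lap k' u = mu u * (k u - k' u) by have := step u; lra.
rewrite -mulrA ler_pM2l //; apply: xlnx_convex => // /euler_step_eq0; by case.
Qed.

Lemma fisher_dominates (x y : 'I_m -> R) :
  (forall e, 0 <= x e) -> (forall e, 0 <= y e) ->
  (forall u, \sum_e (x e ^+ 2 + y e ^+ 2) / 4 * ((u == hd e)%:R + (u == tl e)%:R)
      <= mu u) ->
  \sum_u mu u * k u = 1 ->
  \sum_e \sum_f x e * y f * (Num.sqrt (c e) * Num.sqrt (c f)) *
    (`|edge_diff k' e| * `|edge_diff k' f|) <= fisher k'.
Proof.
move=> x0 y0 hw mass.
pose a e := (k' (hd e) + k' (tl e)) / 2.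
pose b e := c e * (edge_diff k' e * edge_diff (fun u => ln (k' u)) e).
pose p e := Num.sqrt (c e) * `|edge_diff k' e|.
have a0 e : 0 <= a e by rewrite divr_ge0 // addr_ge0.
have b0 e : 0 <= b e by rewrite mulr_ge0 ?fisher_term_ge0 // ltW.
have p0 e : 0 <= p e by rewrite mulr_ge0 // sqrtr_ge0.
have pab e : p e ^+ 2 <= a e * b e.
  rewrite exprMn (sqr_sqrtr (ltW (c_gt0 e))) real_normK ?num_real //.
  rewrite [leRHS]mulrCA ler_pM2l //; exact: euler_step_logmean.
have f0 : 0 <= fisher k' by apply: sumr_ge0 => e _; exact: b0.
have -> : fisher k' = \sum_e b e by [].
have term e f : x e * y f * (Num.sqrt (c e) * Num.sqrt (c f)) *
    (`|edge_diff k' e| * `|edge_diff k' f|) <=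
    (x e ^+ 2 * a e * b f + y f ^+ 2 * a f * b e) / 2.
  rewrite ler_pdivlMr // mulrC.
  have -> : x e * y f * (Num.sqrt (c e) * Num.sqrt (c f)) *
    (`|edge_diff k' e| * `|edge_diff k' f|) = (x e * p e) * (y f * p f).
    rewrite /p; ring.
  have za (z : R) i : 0 <= z ^+ 2 * a i by apply: mulr_ge0 => //; exact: sqr_ge0.
  (* AM-GM with [a] and [b] paired across the two edges, so that the double sum factors into an
     [a]-sum times the Fisher information. *)
  apply: prod_le_of_sqr_le; rewrite ?za ?b0 ?(mulr_ge0 (x0 e)) ?(mulr_ge0 (y0 f)) //.
    by rewrite exprMn -[leRHS]mulrA ler_wpM2l ?sqr_ge0.
  by rewrite exprMn -[leRHS]mulrA ler_wpM2l ?sqr_ge0.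
apply: le_trans (_ : (\sum_e (x e ^+ 2 + y e ^+ 2) / 2 * a e) * \sum_e b e <= _).
  apply: le_trans (ler_sum _ (fun e _ => ler_sum _ (fun f _ => term e f))) _.
  under eq_bigr => e _ do rewrite -mulr_suml big_split /= -mulr_sumr -mulr_suml.
  rewrite -mulr_suml big_split /= -mulr_suml -mulr_sumr [X in _ + X]mulrC.
  rewrite [X in _ + X]mulrC -mulrDl -big_split /= mulrAC mulr_suml.
  by rewrite le_eqVlt; apply/orP; left; apply/eqP; congr (_ * _);
    apply: eq_bigr => e _; ring.
(* Regrouped by vertices, this sum integrates [k'] against a measure below [mu], and the total mass
   of [k'] is 1. *)
have h : \sum_e (x e ^+ 2 + y e ^+ 2) / 2 * a e <= 1.
  rewrite -[leRHS]mass -euler_step_mass.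
  apply: le_trans (_ : \sum_u (\sum_e (x e ^+ 2 + y e ^+ 2) / 4 *
     ((u == hd e)%:R + (u == tl e)%:R)) * k' u <= _); last first.
    by apply: ler_sum => u _; rewrite ler_wpM2r.
  under [leRHS]eq_bigr => u _ do rewrite mulr_suml.
  rewrite exchange_big /=; apply: ler_sum => e _.
  under eq_bigr => u _ do rewrite -mulrA (mulrDl (u == hd e)%:R).
  rewrite -mulr_sumr big_split /= !sum_delta /a; lra.
by rewrite -[leRHS]mul1r ler_wpM2r.
Qed.

End OneStep.

(** Integrate the tangent bound [t ln t >= t - 1] against [mu]. *)
Lemma entropy_ge0 k : (forall u, 0 <= k u) -> \sum_u mu u = 1 ->
  \sum_u mu u * k u = 1 -> 0 <= entropy k.
Proof.
move=> k0 mu1 mass; rewrite -[leLHS](subrr (1 : R)) -[X in X - _]mass -[X in _ - X]mu1 -sumrB.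
apply: ler_sum => u _; rewrite -[X in _ - X]mulr1 -mulrBr ler_pM2l //.
have := k0 u; rewrite le_eqVlt => /orP[/eqP <-|ku]; first by rewrite mul0r; lra.
have := @xlnx_convex R 1 (k u) ler01 (ltW ku); rewrite ln1 mulr0 subr0 add0r mulr1.
by apply => /eqP; rewrite oner_eq0.
Qed.

Lemma entropy_le_ln_card : \sum_u mu u = 1 ->
  \sum_u mu u * - ln (mu u) <= ln (n%:R : R).
Proof.
move=> mu1.
have n0 : 0 < n%:R :> R.
  rewrite ltr0n lt0n; apply: contra_eq_neq mu1 => n0.
  by rewrite big1 1?eq_sym ?oner_eq0 // => -[i hi]; exfalso; rewrite n0 in hi.
rewrite -subr_le0 -[X in _ - X]mul1r -[X in _ - X * _]mu1 mulr_suml -sumrB.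
apply: le_trans (_ : \sum_u (n%:R^-1 - mu u) <= 0); last first.
  by rewrite sumrB mu1 sumr_const card_ord -[_ *+ n]mulr_natr mulVf ?subrr // gt_eqF.
apply: ler_sum => u _.
(* Compare with the uniform measure: [ln t >= 1 - 1/t] at [t = n mu_u], averaged over [mu]. *)
have h : 0 < mu u * n%:R by rewrite mulr_gt0.
have := ln_ge_sub1V h; rewrite lnM ?posrE // => h1.
have := ler_wpM2l (ltW (mu_gt0 u)) h1.
have -> : mu u * (1 - (mu u * n%:R)^-1) = mu u - n%:R^-1.
  by field; rewrite !gt_eqF.
lra.
Qed.

End GraphHeat.

(** * Incidence matrix, Laplacian and pseudoinverse *)

Lemma col_mul (R : pzSemiRingType) (p q r : nat) (v : 'I_r)
  (A : 'M[R]_(p, q)) (K : 'M[R]_(q, r)) : col v (A *m K) = A *m col v K.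
Proof. by rewrite !colE mulmxA. Qed.

Section MatrixForm.
Variables (R : realType) (n m : nat) (tl hd : 'I_m -> 'I_n) (c : 'I_m -> R).
Hypothesis c_gt0 : forall e, 0 < c e.
Let B := incidence R tl hd.
Let L := laplacian tl hd c.

Lemma diagm_mulE (p q : nat) (d : 'I_p -> R) (K : 'M[R]_(p, q)) u v :
  (diagm d *m K) u v = d u * K u v.
Proof. by rewrite /diagm mul_diag_mx !mxE. Qed.

Lemma mul_diagmE (p q : nat) (d : 'I_p -> R) (K : 'M[R]_(q, p)) u v :
  (K *m diagm d) u v = K u v * d v.
Proof. by rewrite /diagm mul_mx_diag !mxE. Qed.

Lemma diagm_sym (p : nat) (d : 'I_p -> R) : (diagm d)^T = diagm d.
Proof. by rewrite /diagm tr_diag_mx. Qed.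

Lemma qform_diagm (p : nat) (d : 'I_p -> R) z :
  qform (diagm d) z = \sum_u d u * z u 0 ^+ 2.
Proof.
rewrite /qform -mulmxA mxE; apply: eq_bigr => u _.
by rewrite diagm_mulE mxE expr2 mulrCA.
Qed.

Lemma diagm_psd (p : nat) (d : 'I_p -> R) : (forall u, 0 <= d u) -> psdmx (diagm d).
Proof.
by move=> d0 z; rewrite qform_diagm sumr_ge0 // => u _; rewrite mulr_ge0 ?sqr_ge0.
Qed.

Lemma incidence_mulE (q : nat) (K : 'M[R]_(n, q)) e v :
  (B *m K) e v = edge_diff tl hd (fun w => K w v) e.
Proof.
rewrite mxE; under eq_bigr => u _ do rewrite mxE mulrBl.
by rewrite sumrB !sum_delta.
Qed.

Lemma laplacian_mulE (q : nat) (K : 'M[R]_(n, q)) u v :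
  (L *m K) u v = lap tl hd c (fun w => K w v) u.
Proof.
rewrite /L /laplacian -!mulmxA mxE; apply: eq_bigr => e _.
by rewrite diagm_mulE incidence_mulE !mxE mulrC.
Qed.

Lemma laplacian_sym : L^T = L.
Proof. by rewrite /L /laplacian !trmx_mul trmxK diagm_sym mulmxA. Qed.

Lemma laplacian_psd : psdmx L.
Proof. by apply: psdmx_congr; apply: diagm_psd => e; exact: ltW. Qed.

(** On each column the form of [L] is a sum of squared edge differences with positive weights
    [c e]. *)
Lemma laplacian_ker (q : nat) (Y : 'M[R]_(n, q)) : L *m Y = 0 -> B *m Y = 0.
Proof.
move=> LY; apply/matrixP => e v; rewrite [RHS]mxE.
have : qform (diagm c) (B *m col v Y) = 0.
  rewrite /qform trmx_mul -!mulmxA (mulmxA B^T) (mulmxA _ B) -/B -[_ *m B]/L.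
  by rewrite -col_mul LY col0 mulmx0 mxE.
rewrite qform_diagm => /eqP; rewrite psumr_eq0; last first.
  by move=> f _; rewrite mulr_ge0 ?sqr_ge0 // ltW.
move/allP => /(_ e (mem_index_enum _)) /=.
rewrite mulf_eq0 gt_eqF //= sqrf_eq0 -col_mul mxE => /eqP; exact.
Qed.

Section Pinv.
Variable Lp : 'M[R]_n.
Hypothesis hLp : is_MP_pinv L Lp.

(** [L] kills [Lp L - 1] by the first Penrose condition, hence so does [B]. *)
Lemma incidence_pinvl : B *m Lp *m L = B.
Proof.
have [h1 _ _ _] := hLp.
apply/eqP; rewrite -subr_eq0 -{2}[B]mulmx1 -mulmxA -mulmxBr; apply/eqP.
by apply: laplacian_ker; rewrite mulmxBr mulmxA h1 mulmx1 subrr.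
Qed.

Lemma incidence_pinvr : L *m Lp *m B^T = B^T.
Proof.
have [h1 _ h3 _] := hLp.
rewrite -h3 -trmx_mul; congr (_^T).
apply/eqP; rewrite -subr_eq0 -{2}[B]mulmx1 -mulmxBr; apply/eqP.
apply: laplacian_ker; rewrite mulmxBr mulmx1.
have -> : L *m (L *m Lp) = L.
  by rewrite -[RHS]laplacian_sym -[in RHS]h1 trmx_mul h3 laplacian_sym.
exact: subrr.
Qed.

End Pinv.

(** * Kernels of the scheme and approximation of the pseudoinverse *)

Section Kernel.
Variables (mu : 'I_n -> R) (tau : R).
Hypotheses (mu_gt0 : forall u, 0 < mu u) (tau_gt0 : 0 < tau).

Let M := diagm mu.
Let D := diagm (fun u => (mu u)^-1).
Let G := invmx (M + tau *: L).
Let K j := heat M D G j.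

Let DM : D *m M = 1%:M.
Proof.
apply/matrixP => u v; rewrite diagm_mulE !mxE.
by case: eqVneq => [->|_]; rewrite ?mulr1n ?mulr0n ?mulr0 // mulVf // gt_eqF.
Qed.

Let psdM : psdmx M. Proof. by apply: diagm_psd => u; exact: ltW. Qed.
Let psdD : psdmx D.
Proof. by apply: diagm_psd => u; rewrite invr_ge0; exact: ltW. Qed.

Let GA : G *m (M + tau *: L) = 1%:M.
Proof.
(* [M + tau L] is positive definite: a null vector has zero [M]-form, and [mu] is positive. *)
apply: mulVmx; rewrite unitmxE unitfE; apply/det0P => -[v v0 vA].
have h : qform (M + tau *: L) v^T = 0 by rewrite /qform trmxK vA mul0mx mxE.
have h2 : qform M v^T = 0.
  apply/eqP; rewrite eq_le psdM andbT -h qformD lerDl qformZ.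
  by rewrite mulr_ge0 ?laplacian_psd // ltW.
move: h2; rewrite qform_diagm => /eqP; rewrite psumr_eq0; last first.
  by move=> f _; rewrite mulr_ge0 ?sqr_ge0 // ltW.
move/allP => h2; move/eqP: v0; apply; apply/rowP => u.
have := h2 u (mem_index_enum _); rewrite mulf_eq0 gt_eqF //= sqrf_eq0 !mxE.
by move/eqP.
Qed.

Let symM : M^T = M := diagm_sym mu.
Let stepK j : M *m K j - M *m K j.+1 = tau *: (L *m K j.+1).
Proof. exact: heat_step. Qed.
Let symK j : (K j)^T = K j.
Proof. exact: (heat_sym symM laplacian_sym DM GA). Qed.

Lemma kernel_step j v :
  euler_step tl hd c mu tau (fun u => K j u v) (fun u => K j.+1 u v).
Proof.
move=> u; rewrite -laplacian_mulE -!(diagm_mulE mu) -/M.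
have -> : M *m K j = M *m K j.+1 + tau *: (L *m K j.+1).
  by rewrite -stepK addrC subrK.
by rewrite mxE; congr (_ + _); rewrite mxE.
Qed.

Lemma kernel_ge0 j v u : 0 <= K j u v.
Proof.
elim: j u => [|j IH] u.
  rewrite -[K 0]/D !mxE; case: eqVneq => _; rewrite ?mulr0n // mulr1n invr_ge0; exact: ltW.
exact: (euler_step_ge0 c_gt0 mu_gt0 tau_gt0 (kernel_step j v)).
Qed.

Lemma kernel_mass j v : \sum_u mu u * K j u v = 1.
Proof.
elim: j => [|j IH]; last by rewrite (euler_step_mass (kernel_step j v)).
rewrite (bigD1 v) //= big1 => [|u /negbTE uv].
  by rewrite -[K 0]/D !mxE eqxx mulr1n mulfV ?addr0 // gt_eqF.
by rewrite -[K 0]/D !mxE uv mulr0n mulr0.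
Qed.

Lemma kernel_entropy0 v : entropy mu (fun u => K 0 u v) = - ln (mu v).
Proof.
rewrite /entropy (bigD1 v) //= big1 => [|u /negbTE uv].
  by rewrite -[K 0]/D !mxE eqxx mulr1n mulVKf ?addr0 ?lnV ?posrE // gt_eqF.
by rewrite -[K 0]/D !mxE uv mulr0n mul0r mulr0.
Qed.

Lemma sum_fisher_le N v : \sum_u mu u = 1 ->
  tau * \sum_(j < N) fisher tl hd c (fun u => K j.+1 u v) <= - ln (mu v).
Proof.
move=> mu1; rewrite -kernel_entropy0.
suff h : tau * \sum_(j < N) fisher tl hd c (fun u => K j.+1 u v) <=
    entropy mu (fun u => K 0 u v) - entropy mu (fun u => K N u v).
  apply: le_trans h _; rewrite gerBl; apply: entropy_ge0 => // [u|].
    exact: kernel_ge0.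
  exact: kernel_mass.
elim: N => [|N IH]; first by rewrite big_ord0 mulr0 subrr.
rewrite big_ord_recr /= mulrDr.
have := euler_step_entropy c_gt0 mu_gt0 tau_gt0 (kernel_step N v)
  (fun u => kernel_ge0 N v u).
lra.
Qed.

(** Split the kernel at half time, [K (j + j) = K j M K j]; this is why only even kernels enter the
    Riemann sum. *)
Lemma kernel_square_le j e f :
  `|(B *m K (j + j) *m B^T) e f| <= \sum_v mu v *
    (`|edge_diff tl hd (fun u => K j u v) e| *
     `|edge_diff tl hd (fun u => K j u v) f|).
Proof.
have -> : B *m K (j + j) *m B^T = (B *m K j) *m (M *m (B *m K j)^T).
  by rewrite /K (heat_add _ DM) trmx_mul (symK j) !mulmxA.
rewrite mxE; apply: le_trans (ler_norm_sum _ _ _) _.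
apply: ler_sum => v _; rewrite diagm_mulE [X in _ * (_ * X)]mxE !incidence_mulE !normrM.
by rewrite (gtr0_norm (mu_gt0 v)) mulrCA.
Qed.

Section Pair.
Variables (x y : 'I_m -> R).
Hypotheses (x_ge0 : forall e, 0 <= x e) (y_ge0 : forall e, 0 <= y e).
Hypothesis mu_ge : forall u,
  \sum_e (x e ^+ 2 + y e ^+ 2) / 4 * ((u == hd e)%:R + (u == tl e)%:R) <= mu u.
Hypothesis mu1 : \sum_u mu u = 1.

(** For each [j] and [v], [fisher_dominates] bounds the form by the Fisher information, whose sum
    with step [tau] is an entropy. The Riemann sum has step [2 tau], whence the factor 2. *)
Lemma kernel_bilinear_le N :
  \sum_e \sum_f x e * y f * (Num.sqrt (c e) * Num.sqrt (c f)) *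
    (2 * tau * \sum_(j < N) `|(B *m K (j.+1 + j.+1) *m B^T) e f|) <= 2 * ln n%:R.
Proof.
have h1 : \sum_e \sum_f x e * y f * (Num.sqrt (c e) * Num.sqrt (c f)) *
    (\sum_(j < N) `|(B *m K (j.+1 + j.+1) *m B^T) e f|) <=
    \sum_v mu v * \sum_(j < N) fisher tl hd c (fun u => K j.+1 u v).
  under eq_bigr => e _ do under eq_bigr => f _ do rewrite mulr_sumr.
  under eq_bigr => e _ do rewrite exchange_big.
  rewrite exchange_big /=.
  under [leRHS]eq_bigr => v _ do rewrite mulr_sumr.
  rewrite [leRHS]exchange_big /=; apply: ler_sum => j _.
  apply: le_trans (_ : \sum_v mu v * (\sum_e \sum_f x e * y f *
    (Num.sqrt (c e) * Num.sqrt (c f)) *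
    (`|edge_diff tl hd (fun u => K j.+1 u v) e| *
     `|edge_diff tl hd (fun u => K j.+1 u v) f|)) <= _); last first.
    apply: ler_sum => v _; rewrite ler_pM2l //.
    exact: (fisher_dominates c_gt0 mu_gt0 tau_gt0 (kernel_step j v)
      (fun u => kernel_ge0 j v u) x_ge0 y_ge0 mu_ge (kernel_mass j v)).
  under [leRHS]eq_bigr => v _ do rewrite mulr_sumr.
  rewrite [leRHS]exchange_big /=; apply: ler_sum => e _.
  under [leRHS]eq_bigr => v _ do rewrite mulr_sumr.
  rewrite [leRHS]exchange_big /=; apply: ler_sum => f _.
  under [leRHS]eq_bigr => v _ do rewrite mulrCA.
  rewrite -mulr_sumr ler_wpM2l ?kernel_square_le //.
  by rewrite !mulr_ge0 ?sqrtr_ge0.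
have h2 : tau * (\sum_v mu v * \sum_(j < N) fisher tl hd c (fun u => K j.+1 u v))
    <= ln n%:R.
  apply: le_trans (entropy_le_ln_card mu_gt0 mu1).
  rewrite mulr_sumr; apply: ler_sum => v _.
  by rewrite mulrCA ler_pM2l // sum_fisher_le.
apply: le_trans (_ : 2 * (tau * (\sum_v mu v *
   \sum_(j < N) fisher tl hd c (fun u => K j.+1 u v))) <= _); last by rewrite ler_pM2l.
rewrite mulrA; apply: le_trans (_ : (2 * tau) * (\sum_e \sum_f x e * y f *
    (Num.sqrt (c e) * Num.sqrt (c f)) *
    (\sum_(j < N) `|(B *m K (j.+1 + j.+1) *m B^T) e f|)) <= _).
  rewrite le_eqVlt; apply/orP; left; apply/eqP.
  rewrite mulr_sumr; apply: eq_bigr => e _; rewrite mulr_sumr; apply: eq_bigr => f _.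
  by rewrite mulrCA.
by rewrite ler_pM2l // mulr_gt0.
Qed.

End Pair.

Variable Lp : 'M[R]_n.
Hypothesis hLp : is_MP_pinv L Lp.

Lemma pinv_approx N e f (z := (row e (B *m Lp))^T) (w := col f (Lp *m B^T)) :
  `|(B *m Lp *m B^T) e f| <=
    2 * tau * \sum_(j < N.+1) `|(B *m K (j.+1 + j.+1) *m B^T) e f|
    + ((qform M z + qform M w) / 2) / ((N.+1 + N.+1)%:R * tau)
    + tau * ((qform (L *m D *m L) z + qform (L *m D *m L) w) / 2).
Proof.
pose E := heat_defect M D G L tau N.+1.
(* Write [Lp = Lp L Lp] and split the inner [L] into the Riemann sum and the defect [E]; between
   [B Lp] and [Lp B^T] the outer factors [L] of each summand cancel. *)
have eqE : B *m Lp *m B^T =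
    (2 * tau) *: (\sum_(j < N.+1) B *m K (j.+1 + j.+1) *m B^T)
      + B *m Lp *m E *m (Lp *m B^T).
  have [_ h2 _ _] := hLp.
  rewrite /E /heat_defect mulmxBr mulmxBl.
  have -> : B *m Lp *m L *m (Lp *m B^T) = B *m Lp *m B^T.
    by rewrite (incidence_pinvl hLp) mulmxA.
  rewrite -scalemxAr -scalemxAl mulmx_sumr mulmx_suml.
  rewrite [X in _ *: X + _](eq_bigr (fun j : 'I_N.+1 =>
    B *m Lp *m (L *m K (j.+1 + j.+1) *m L) *m (Lp *m B^T))); last first.
    move=> j _; set X := K _.
    have -> : B *m Lp *m (L *m X *m L) *m (Lp *m B^T) =
        (B *m Lp *m L) *m X *m (L *m Lp *m B^T) by rewrite !mulmxA.
    by rewrite (incidence_pinvl hLp) (incidence_pinvr hLp).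
  by rewrite addrC subrK.
have entE : (B *m Lp *m E *m (Lp *m B^T)) e f = (z^T *m E *m w) 0 0.
  by rewrite /z /w trmxK -!row_mul -col_mul !mxE.
have symE : E^T = E := heat_defect_sym symM laplacian_sym DM GA N.+1.
have psdE : psdmx E.
  exact: (heat_defect_psd symM laplacian_sym psdD laplacian_psd tau_gt0 DM GA N).
have boundE v : qform E v <= qform M v / ((N.+1 + N.+1)%:R * tau)
    + tau * qform (L *m D *m L) v.
  exact: (heat_defect_le symM laplacian_sym psdM psdD laplacian_psd tau_gt0 DM GA N).
rewrite {1}eqE mxE entE; apply: le_trans (ler_normD _ _) _.
rewrite -addrA; apply: lerD.
  rewrite mxE summxE normrM gtr0_norm ?mulr_gt0 // ler_pM2l ?mulr_gt0 //.
  exact: ler_norm_sum.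
apply: le_trans (psdmx_bilinear_le z w symE psdE) _.
have := boundE z; have := boundE w; set d := _ * tau; lra.
Qed.

End Kernel.

End MatrixForm.

(** * Removing the error terms, and reducing the spectral norm to a bilinear form *)

Lemma le_of_vanishing_error (R : realType) (F a X Y : R) : 0 <= X -> 0 <= Y ->
  (forall (tau : R) N, 0 < tau ->
     F <= a + X / ((N.+1 + N.+1)%:R * tau) + tau * Y) -> F <= a.
Proof.
move=> X0 Y0 h; apply/ler_addgt0Pr => eps eps0.
have Y1 : 0 < Y + 1 by lra.
(* [tau] is fixed first, and [N] only afterwards: the truncation error needs [N tau] large. Dividing
   by [Y + 1] covers [Y = 0]. *)
pose tau := eps / 2 / (Y + 1).
have tau0 : 0 < tau by rewrite !divr_gt0 ?ltr0n.
have tauY : tau * Y <= eps / 2.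
  have -> : tau * Y = eps / 2 * Y / (Y + 1) by rewrite /tau mulrAC.
  by rewrite ler_pdivrMr // ler_pM2l ?divr_gt0 // lerDl.
move: tau tau0 tauY => tau tau0 tauY.
pose N := Num.bound (X / (eps * tau)).
have et : 0 < eps * tau by rewrite mulr_gt0.
have hN : X < N%:R * (eps * tau).
  by rewrite -ltr_pdivrMr //; apply: archi_boundP; rewrite divr_ge0 // ltW.
have hX : X / ((N.+1 + N.+1)%:R * tau) <= eps / 2.
  rewrite ler_pdivrMr ?mulr_gt0 //.
  have -> : (N.+1 + N.+1)%:R = 2 * (N%:R + 1) :> R by rewrite natrD -natr1; ring.
  have -> : eps / 2 * (2 * (N%:R + 1) * tau) = N%:R * (eps * tau) + eps * tau by field.
  lra.
have := h tau N tau0; lra.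
Qed.

Lemma spec_norm_le (R : realType) (m : nat) (A : 'M[R]_m) (a : R) : 0 < a ->
  (forall x y : 'I_m -> R, (forall e, 0 <= x e) -> (forall e, 0 <= y e) ->
     \sum_e \sum_f x e * y f * `|A e f| <= a * ((\sum_e (x e ^+ 2 + y e ^+ 2)) / 2)) ->
  spec_norm (map_mx (fun x => `|x|) A) <= a.
Proof.
move=> a0 hA; apply: ge_sup.
  exists 0, 0 => /=.
    by rewrite /norm2 big1 ?sqrtr0 // => i _; rewrite mxE expr0n.
  by rewrite /norm2 mulmx0 big1 ?sqrtr0 // => i _; rewrite mxE expr0n.
move=> _ [z /= hz <-].
set g := map_mx _ A *m z.
have S0 : 0 <= \sum_e g e 0 ^+ 2 by apply: sumr_ge0 => e _; exact: sqr_ge0.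
have Z1 : \sum_e z e 0 ^+ 2 <= 1.
  have Z0 : 0 <= \sum_e z e 0 ^+ 2 by apply: sumr_ge0 => e _; exact: sqr_ge0.
  by rewrite -(sqr_sqrtr Z0) expr_le1 // sqrtr_ge0.
(* Testing against [g] itself, scaled to balance the two squares. *)
have := hA (fun e => `|g e 0| / a) (fun e => `|z e 0|)
  (fun e => divr_ge0 (normr_ge0 _) (ltW a0)) (fun e => normr_ge0 _).
have -> : \sum_e ((`|g e 0| / a) ^+ 2 + `|z e 0| ^+ 2) =
    (\sum_e g e 0 ^+ 2) / a ^+ 2 + \sum_e z e 0 ^+ 2.
  rewrite big_split /= mulr_suml; congr (_ + _); apply: eq_bigr => e _.
    by rewrite expr_div_n real_normK ?num_real.
  by rewrite real_normK ?num_real.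
have h1 : (\sum_e g e 0 ^+ 2) / a <= \sum_e \sum_f `|g e 0| / a * `|z f 0| * `|A e f|.
  rewrite mulr_suml; apply: ler_sum => e _.
  have -> : \sum_f `|g e 0| / a * `|z f 0| * `|A e f| =
      `|g e 0| / a * (\sum_f `|A e f| * `|z f 0|).
    by rewrite mulr_sumr; apply: eq_bigr => f _; rewrite -mulrA [X in _ * X]mulrC.
  rewrite -(real_normK (num_real (g e 0))) expr2 mulrAC ler_wpM2l //.
    by rewrite divr_ge0 // ltW.
  rewrite {1}/g mxE; apply: le_trans (ler_norm_sum _ _ _) _.
  by apply: ler_sum => f _; rewrite mxE normrM normr_id.
move=> /(le_trans h1); rewrite /norm2 => h2.
rewrite -(ger0_norm (ltW a0)) -sqrtr_sqr ler_wsqrtr //.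
set S := \sum_e _ in h2 S0 *.
have : S / a * a <= a * ((S / a ^+ 2 + \sum_e z e 0 ^+ 2) / 2) * a by rewrite ler_wpM2r // ltW.
rewrite divfK ?gt_eqF //.
have -> : a * ((S / a ^+ 2 + \sum_e z e 0 ^+ 2) / 2) * a =
   (S + a ^+ 2 * \sum_e z e 0 ^+ 2) / 2 by field; rewrite gt_eqF.
(* Now [S <= (S + a^2) / 2], that is, [S <= a^2]. *)
have := ler_wpM2l (sqr_ge0 a) Z1; lra.
Qed.

(** * The bilinear estimate for the absolute value of [projPi], and the theorem *)

Section MainEstimate.
Variables (R : realType) (n m : nat) (tl hd : 'I_m -> 'I_n) (c : 'I_m -> R).
Variable Lp : 'M[R]_n.
Hypotheses (n_gt0 : (0 < n)%N) (c_gt0 : forall e, 0 < c e).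
Hypothesis hLp : is_MP_pinv (laplacian tl hd c) Lp.
Let B := incidence R tl hd.

Lemma projPiE e f : projPi tl hd c Lp e f =
  Num.sqrt (c e) * (B *m Lp *m B^T) e f * Num.sqrt (c f).
Proof. by rewrite /projPi mul_diagmE -!mulmxA diagm_mulE !mulmxA. Qed.

Lemma projPi_form_lt1 (x y : 'I_m -> R) :
  (forall e, 0 <= x e) -> (forall e, 0 <= y e) ->
  (\sum_e (x e ^+ 2 + y e ^+ 2)) / 2 < 1 ->
  \sum_e \sum_f x e * y f * `|projPi tl hd c Lp e f| <= 2 * ln n%:R.
Proof.
move=> x0 y0 s1; set s := _ / 2 in s1.
have n0 : 0 < n%:R :> R by rewrite ltr0n.
pose w u := \sum_e (x e ^+ 2 + y e ^+ 2) / 4 * ((u == hd e)%:R + (u == tl e)%:R).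
(* The missing mass [1 - s] is spread uniformly; the strict bound [s < 1] makes [mu] positive
   everywhere. *)
pose mu u := w u + (1 - s) / n%:R.
have slack : 0 < (1 - s) / n%:R by rewrite divr_gt0 // subr_gt0.
have w0 u : 0 <= w u.
  apply: sumr_ge0 => e _; rewrite mulr_ge0 ?addr_ge0 ?ler0n //.
  by rewrite divr_ge0 ?addr_ge0 ?sqr_ge0.
have mu0 u : 0 < mu u by rewrite ltr_wpDl.
have mu_ge u : w u <= mu u by rewrite lerDl ltW.
have ws : \sum_u w u = s.
  rewrite /w exchange_big /s mulr_suml; apply: eq_bigr => e _ /=.
  rewrite -mulr_sumr big_split /=.
  have d (i : 'I_n) : \sum_u ((u == i)%:R : R) = 1.
    by rewrite -[RHS](sum_delta i (fun=> 1)); apply: eq_bigr => u _; rewrite mulr1.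
  by rewrite !d; field.
have mu1 : \sum_u mu u = 1.
  rewrite big_split /= ws sumr_const card_ord -[_ *+ n]mulr_natr divfK ?gt_eqF //; ring.
pose xy e f := x e * y f * (Num.sqrt (c e) * Num.sqrt (c f)).
have xy0 e f : 0 <= xy e f by rewrite !mulr_ge0 ?sqrtr_ge0.
pose M := diagm mu; pose L := laplacian tl hd c.
pose LDL := L *m diagm (fun u => (mu u)^-1) *m L.
pose z e := (row e (B *m Lp))^T; pose z' f := col f (Lp *m B^T).
pose X e f := (qform M (z e) + qform M (z' f)) / 2.
pose Y e f := (qform LDL (z e) + qform LDL (z' f)) / 2.
have M0 : psdmx M by apply: diagm_psd => u; exact: ltW.
have LDL0 : psdmx LDL.
  rewrite /LDL -{1}[L](laplacian_sym tl hd c); apply: psdmx_congr.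
  by apply: diagm_psd => u; rewrite invr_ge0 ltW.
have X0 e f : 0 <= X e f by rewrite divr_ge0 ?addr_ge0.
have Y0 e f : 0 <= Y e f by rewrite divr_ge0 ?addr_ge0.
have pull (F : 'I_m -> 'I_m -> R) : (forall e f, 0 <= F e f) ->
    0 <= \sum_e \sum_f xy e f * F e f.
  by move=> F0; apply: sumr_ge0 => e _; apply: sumr_ge0 => f _; rewrite mulr_ge0.
(* The error coefficients depend on [mu] and [Lp], but not on [tau] or [N]. *)
apply: (le_of_vanishing_error (pull X X0) (pull Y Y0)) => tau N tau0.
have := kernel_bilinear_le c_gt0 mu0 tau0 x0 y0 mu_ge mu1 N.+1.
rewrite -/B => main.
rewrite -addrA -lerBlDr; apply: le_trans main.
rewrite lerBlDr !mulr_suml mulr_sumr -!big_split /=; apply: ler_sum => e _.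
rewrite mulr_suml mulr_sumr -!big_split /=; apply: ler_sum => f _.
have -> : x e * y f * `|projPi tl hd c Lp e f| = xy e f * `|(B *m Lp *m B^T) e f|.
  by rewrite projPiE !normrM !(ger0_norm (sqrtr_ge0 _)) /xy; ring.
have := pinv_approx c_gt0 mu0 tau0 hLp N e f.
move=> /(ler_wpM2l (xy0 e f)) /le_trans; apply.
rewrite -/(X e f) -/(Y e f) -/(xy e f) !mulrDr.
rewrite le_eqVlt; apply/orP; left; apply/eqP.
by rewrite -!addrA; congr (_ + (_ + _)); [rewrite mulrA | rewrite mulrCA].
Qed.

Lemma projPi_form_le (x y : 'I_m -> R) :
  (forall e, 0 <= x e) -> (forall e, 0 <= y e) ->
  \sum_e \sum_f x e * y f * `|projPi tl hd c Lp e f| <=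
    2 * ln n%:R * ((\sum_e (x e ^+ 2 + y e ^+ 2)) / 2).
Proof.
move=> x0 y0; set F := \sum_e _; set s := _ / 2.
have s0 : 0 <= s.
  by rewrite divr_ge0 // sumr_ge0 // => e _; rewrite addr_ge0 ?sqr_ge0.
have a0 : 0 <= 2 * ln n%:R :> R by rewrite mulr_ge0 // ln_ge0 // ler1n.
(* By homogeneity, dividing [x] and [y] by the square root of any [t > s] brings the mass below 1;
   then [t] decreases to [s]. A zero constant is treated apart, since the choice of [t] divides by
   it. *)
suff h (t : R) : s < t -> F <= 2 * ln n%:R * t.
  have [e0|a1] := eqVneq (2 * ln n%:R : R) 0.
    by have := h (s + 1); rewrite e0 !mul0r ltrDl ltr01; exact.
  have {}a0 : 0 < 2 * ln n%:R :> R by rewrite lt_def a1.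
  apply/ler_addgt0Pr => eps eps0.
  have := h (s + eps / (2 * ln n%:R)).
  by rewrite ltrDl divr_gt0 // mulrDr [X in _ + X]mulrCA divff ?mulr1 ?gt_eqF //; exact.
move=> st; have t0 : 0 < t by apply: le_lt_trans st.
pose q := Num.sqrt t; have q0 : 0 < q by rewrite sqrtr_gt0.
have qq : q ^+ 2 = t by rewrite sqr_sqrtr // ltW.
move: q q0 qq => q q0 qq.
have := @projPi_form_lt1 (fun e => x e / q) (fun e => y e / q)
  (fun e => divr_ge0 (x0 e) (ltW q0)) (fun e => divr_ge0 (y0 e) (ltW q0)).
have -> : (\sum_e ((x e / q) ^+ 2 + (y e / q) ^+ 2)) / 2 = s / t.
  rewrite /s mulrAC; congr (_ / _); rewrite mulr_suml; apply: eq_bigr => e _.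
  by rewrite !expr_div_n qq mulrDl.
have -> : \sum_e \sum_f x e / q * (y f / q) * `|projPi tl hd c Lp e f| = F / t.
  rewrite mulr_suml; apply: eq_bigr => e _; rewrite mulr_suml; apply: eq_bigr => f _.
  by rewrite -qq; field; rewrite gt_eqF.
by rewrite (ltr_pdivrMr _ _ t0) mul1r ler_pdivrMr //; exact.
Qed.

End MainEstimate.

Theorem theorem1p3 (R : realType) (n m : nat) (tl hd : 'I_m -> 'I_n)
  (c : 'I_m -> R) (Lp : 'M[R]_n)
  (hn : (2 <= n)%N)
  (hloop : forall e, tl e != hd e)
  (hc : forall e, 0 < c e)
  (hLp : is_MP_pinv (laplacian tl hd c) Lp) :
  spec_norm (map_mx (fun x : R => `|x|) (projPi tl hd c Lp))
    <= 2 * ln (n%:R : R).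
Proof.
apply: spec_norm_le => [|x y x0 y0].
  by rewrite mulr_gt0 // ln_gt0 // ltr1n.
by apply: projPi_form_le => //; exact: ltnW.
Qed.
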